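(* Let $G=F_N$ be a free group of finite rank $N\ge 2$. Then \[ \mathrm{RF}_G(n)\le f_{prim}(4n+4)\qquad\text{for all } n\ge 1. \]
   Context: Fix a free basis $A$ of $F_N$ and let $|g|_A$ be the word length of $g$ with respect to $A$. For $1\ne g\in F_N$, $D(g)$ is the minimum of $[F_N:H]$ over all finite-index subgroups $H\le F_N$ with $g\notin H$, and the residual finiteness growth function is $\mathrm{RF}_{G}(n)=\max\{D(g): g\in F_N,\ |g|_A\le n,\ g\ne 1\}$. For $1\ne g\in F_N$, $d_{prim}(g)$ is the minimum of $[F_N:H]$ over all finite-index subgroups $H\le F_N$ such that $g\in H$ and $g$ is primitive in $H$ (i.e. $g$ belongs to some free basis of $H$). The primitivity index function is $f_{prim}(n)=\max\{d_{prim}(g): g\in F_N,\ |g|_A\le n,\ g\neq 1,\ g \text{ is not a proper power in } F_N\}$. *)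

(* Defs.v *)
From HB Require Import structures.
From mathcomp Require Import all_boot.
From mathcomp Require Import boolp classical_sets functions cardinality.

Set Implicit Arguments.
Unset Strict Implicit.
Unset Printing Implicit Defensive.

Local Open Scope classical_set_scope.
Local Open Scope group_scope.

Definition is_min (S : set nat) (m : nat) : Prop :=
  S m /\ forall k, S k -> (m <= k)%N.

Definition is_max (S : set nat) (m : nat) : Prop :=
  S m /\ forall k, S k -> (k <= m)%N.

(* [min_nat S] is the least element of [S] and [max_nat S] the greatest one;
   both are 0 when there is no such element.  The sets used below do have one:
   the minima are over non-empty sets (free groups are residually finite, and
   by M. Hall's theorem every nontrivial element is primitive in some subgroup
   of finite index), and balls in a free group of finite rank are finite. *)
Definition min_nat (S : set nat) : nat := xget 0%N [set m | is_min S m].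
Definition max_nat (S : set nat) : nat := xget 0%N [set m | is_max S m].

Section FreeGroup.
Context {G : groupType}.
Implicit Types (A B H : set G) (g : G).

(* A word is a list of letters: [(x, false)] stands for x and [(x, true)] for
   the inverse of x. *)
Definition word : Type := seq (G * bool).

Definition letter_val (l : G * bool) : G := if l.2 then l.1^-1 else l.1.

Definition word_val (w : word) : G := \prod_(l <- w) letter_val l.

Definition word_over B (w : word) : Prop := forall l, l \in w -> B l.1.

Definition reduced (w : word) : bool :=
  sorted (fun l l' => ~~ ((l.1 == l'.1) && (l.2 != l'.2))) w.

Definition is_subgroup H : Prop := group_closed (mem H).

(* For [H := setT] this says that G itself is free on B. *)
Definition free_basis B H : Prop :=
  [/\ is_subgroup H,
      H = [set word_val w | w in word_over B]
    & forall w, word_over B w -> reduced w -> w <> [::] -> word_val w <> 1].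

Definition primitive_in g H : Prop := exists2 B, free_basis B H & B g.

Definition left_cosets H : set (set G) :=
  range (fun x : G => [set x * h | h in H]).

Definition has_index H (k : nat) : Prop := is_subgroup H /\ (left_cosets H #= `I_k)%card.

Definition proper_power g : Prop :=
  exists (h : G) (k : nat), (2 <= k)%N /\ g = h ^+ k.

Definition word_length A g : nat :=
  min_nat [set size w | w in [set w : word | word_over A w /\ word_val w = g]].

Definition Dindex g : nat :=
  min_nat [set k | exists2 H : set G, has_index H k & ~ H g].

Definition dprim g : nat :=
  min_nat [set k | exists2 H : set G, has_index H k & H g /\ primitive_in g H].

Definition RF A (n : nat) : nat :=
  max_nat [set Dindex g | g in [set g | (word_length A g <= n)%N /\ g <> 1]].

Definition fprim A (n : nat) : nat :=
  max_nat [set dprim g | g in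
    [set g | [/\ (word_length A g <= n)%N, g <> 1 & ~ proper_power g]]].

End FreeGroup.

(* Main.v *)
Require Import Defs.
From HB Require Import structures.
From mathcomp Require Import all_boot perm zmodp.
From mathcomp Require Import boolp classical_sets functions cardinality.

(** Let [g] be a nontrivial element of length at most [n] realising the maximum
    RF(n).  For a suitable letter [x], the commutator [[g, x g x^-1]] is
    nontrivial ([noncommuting_conjugate]); it has length at most [4 n + 4], and
    so does its root [u], an element that is not a proper power and satisfies
    [u ^ k = [g, x g x^-1]] for some [k > 0] ([exists_root]).

    If [u] is primitive in a subgroup [H], then [H] cannot contain both [g] and
    [x g x^-1]: sending [u] to 1 and the other elements of a free basis of [H]
    to 0 defines a homomorphism from [H] to a cyclic group of order larger than
    [k], which kills commutators but not [u ^ k] ([primitive_power_ncommg]).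
    Hence [H], or its conjugate by [x], omits [g].  As the two have the same
    index, [D(g) <= d_prim(u) <= f_prim(4 n + 4)].

    Passing to the root avoids the theorem that commutators in a free group are
    not proper powers; it only requires that taking a power lengthens an element.

    With the convention that the minimum over the empty set is 0, the argument
    also requires that [d_prim(u)] be attained, which is M. Hall's theorem
    ([primitive_in_finite_index]).  Up to conjugation [u] is spelled by a
    cyclically reduced word [r].  Label an oriented cycle of length [size r] by
    [r]; each generator then acts as a partial injection on the vertices, which
    extends to a permutation.  The stabiliser of the base vertex has finite
    index, and the Schreier generators with respect to the spanning path (the
    cycle without its last edge) form a free basis of it, in which the last edge
    of the cycle gives [r] or its inverse.  Their freeness is a normal form
    argument: in a product of such generators the letters carried by edges
    outside the spanning path never cancel ([schreier_normal_form]). *)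

Set Implicit Arguments.
Unset Strict Implicit.
Unset Printing Implicit Defensive.

Local Open Scope classical_set_scope.
Local Open Scope group_scope.

(** * Words and reduction *)

Section Words.
Context {G : groupType}.
Implicit Types (K : groupType) (A B H : set G) (g h : G) (l x y : G * bool) (w s t : @word G).

Definition linv l : G * bool := (l.1, ~~ l.2).
Definition winv w : word := rev (map linv w).

Lemma linvK : involutive linv.
Proof. by case=> a e; rewrite /linv /= negbK. Qed.

Lemma linv_neq l : linv l != l.
Proof. by case: l => a []; apply/eqP => -[]. Qed.

Lemma eq_linv l l' : (l == linv l') = (linv l == l').
Proof. by rewrite -(inj_eq (inv_inj linvK)) linvK. Qed.

Lemma winv_cons l w : winv (l :: w) = rcons (winv w) (linv l).
Proof. by rewrite /winv /= rev_cons. Qed.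

Lemma winv_rcons l w : winv (rcons w l) = linv l :: winv w.
Proof. by rewrite /winv map_rcons rev_rcons. Qed.

Lemma size_winv w : size (winv w) = size w.
Proof. by rewrite /winv size_rev size_map. Qed.

(** The letter [(a, true)] stands for the inverse of [a], so a map on generators
    is extended to letters, and then to words, as [letter_val] and [word_val] do;
    these are the case where [f] is the identity. *)
Definition lift (K : groupType) (f : G -> K) l : K :=
  if l.2 then (f l.1)^-1 else f l.1.

Definition word_map (K : groupType) (f : G -> K) w : K := \prod_(l <- w) lift f l.

Lemma word_map_cons K (f : G -> K) l w :
  word_map f (l :: w) = lift f l * word_map f w.
Proof. by rewrite /word_map big_cons. Qed.

Lemma word_map_cat K (f : G -> K) s t :
  word_map f (s ++ t) = word_map f s * word_map f t.
Proof. by rewrite /word_map big_cat. Qed.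

Lemma word_map1 K (f : G -> K) l : word_map f [:: l] = lift f l.
Proof. by rewrite /word_map big_seq1. Qed.

Lemma lift_linv K (f : G -> K) l : lift f (linv l) = (lift f l)^-1.
Proof. by case: l => a [] /=; rewrite /lift //= invgK. Qed.

Lemma word_map_winv K (f : G -> K) w : word_map f (winv w) = (word_map f w)^-1.
Proof.
elim: w => [|l w IH]; first by rewrite /word_map /winv /rev /= !big_nil invg1.
by rewrite winv_cons -cats1 word_map_cat IH word_map1 lift_linv word_map_cons invgM.
Qed.

Lemma word_val_nil : word_val ([::] : @word G) = 1.
Proof. by rewrite /word_val big_nil. Qed.

Lemma word_val_cons l w : word_val (l :: w) = letter_val l * word_val w.
Proof. exact: (word_map_cons id). Qed.

Lemma word_val_cat s t : word_val (s ++ t) = word_val s * word_val t.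
Proof. exact: (word_map_cat id). Qed.

Lemma word_val1 l : word_val [:: l] = letter_val l.
Proof. exact: (word_map1 id). Qed.

Lemma word_val_rcons w l : word_val (rcons w l) = word_val w * letter_val l.
Proof. by rewrite -cats1 word_val_cat word_val1. Qed.

Lemma letter_val_linv l : letter_val (linv l) = (letter_val l)^-1.
Proof. exact: (lift_linv id). Qed.

Lemma word_val_winv w : word_val (winv w) = (word_val w)^-1.
Proof. exact: (word_map_winv id). Qed.

Lemma reducedE w : reduced w = sorted (fun l l' => l' != linv l) w.
Proof.
by apply: eq_sorted => -[a e] [b e'] /=;
  rewrite /linv xpair_eqE /= (eq_sym b); case: (a == b) e e' => [] [] [].
Qed.

(** Being reduced is a condition on consecutive letters, so a concatenation is
    reduced as soon as both factors are and the two letters at the junction do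
    not cancel. *)
Lemma reduced_rcons_cat s x y t :
  reduced (rcons s x ++ y :: t) =
  [&& reduced (rcons s x), y != linv x & reduced (y :: t)].
Proof.
rewrite !reducedE; case: s => [|z s] //=.
by rewrite cat_path /= last_rcons.
Qed.

Lemma reduced_rcons2 s x y :
  reduced (rcons (rcons s x) y) = reduced (rcons s x) && (y != linv x).
Proof. by rewrite -(cats1 (rcons s x)) reduced_rcons_cat /= andbT. Qed.

Lemma reduced_cons2 x y t :
  reduced (x :: y :: t) = (y != linv x) && reduced (y :: t).
Proof. by rewrite !reducedE. Qed.

Lemma reduced_catl s t : reduced (s ++ t) -> reduced s.
Proof.
case/lastP: s => // s x; case: t => [|y t]; first by rewrite cats0.
by rewrite reduced_rcons_cat => /and3P[].
Qed.

Lemma reduced_catr s t : reduced (s ++ t) -> reduced t.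
Proof.
case/lastP: s => // s x; case: t => [|y t] //.
by rewrite reduced_rcons_cat => /and3P[].
Qed.

Lemma reduced_winv w : reduced (winv w) = reduced w.
Proof.
elim: w => // x [|y w] IH; first by rewrite /winv.
by rewrite 2!winv_cons reduced_rcons2 -winv_cons IH linvK eq_sym
  andbC reduced_cons2.
Qed.

Lemma word_over_cons B l w : word_over B (l :: w) <-> B l.1 /\ word_over B w.
Proof.
split=> [ov|[Bl ov] k]; last by rewrite inE => /orP[/eqP->|/ov].
by split=> [|k kw]; apply: ov; rewrite inE ?eqxx ?kw ?orbT.
Qed.

Lemma word_over_cat B s t : word_over B (s ++ t) <-> word_over B s /\ word_over B t.
Proof.
elim: s => [|l s IH] /=; first by split=> [|[]].
by rewrite !word_over_cons IH; tauto.
Qed.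

Lemma word_over1 B l : word_over B [:: l] <-> B l.1.
Proof. by split=> [/word_over_cons[]//|Bl]; apply/word_over_cons. Qed.

Lemma word_over_rcons B w l : word_over B (rcons w l) <-> word_over B w /\ B l.1.
Proof. by rewrite -cats1 word_over_cat word_over1. Qed.

Lemma word_over_winv B w : word_over B w -> word_over B (winv w).
Proof. by move=> ov l; rewrite mem_rev => /mapP[k /ov Bk ->]. Qed.

(** Free reduction.  It is invisible to every map from the generators to a group,
    which is the source of the universal property of free bases below. *)
Lemma reduce_word w : exists w',
  [/\ reduced w', (size w' <= size w)%N, {subset w' <= w}
    & forall (K : groupType) (f : G -> K), word_map f w' = word_map f w].
Proof.
elim: w => [|x w [w' [red sz sub eqm]]]; first by exists [::].
case: w' => [|y w'] in red sz sub eqm *.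
  exists [:: x]; split=> // [l|K f]; first by rewrite !inE => ->.
  by rewrite !word_map_cons eqm.
have [eyx|neyx] := eqVneq y (linv x).
  exists w'; split; first exact: (@reduced_catr [:: y]).
  - exact: leq_trans (leqnSn _) (leq_trans sz (leqnSn _)).
  - by move=> l lw; rewrite inE sub ?orbT // inE lw orbT.
  - by move=> K f; rewrite word_map_cons -eqm word_map_cons eyx lift_linv mulVKg.
exists [:: x, y & w']; split=> // [|l|K f].
- by rewrite reduced_cons2 neyx.
- by rewrite inE => /orP[/eqP->|/sub]; rewrite inE ?eqxx // => ->; rewrite orbT.
- by rewrite word_map_cons eqm word_map_cons.
Qed.

End Words.

(** * Free bases: normal forms and the universal property *)

Section FreeBases.
Context {G : groupType}.
Implicit Types (K : groupType) (A B H : set G) (g h : G) (l x y : G * bool).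
Implicit Types (w s t : @word G).

(** At the first place where the two words differ, the inverse of the remainder
    of one followed by the remainder of the other is reduced and nonempty, and
    freeness forbids it to have value 1. *)
Lemma reduced_word_inj B H w w' : free_basis B H ->
  word_over B w -> word_over B w' -> reduced w -> reduced w' ->
  word_val w = word_val w' -> w = w'.
Proof.
case=> _ _ free; elim: w w' => [|x w IH] [|y w'] // ovw ovw' redw redw' eqv.
- by case: (free (y :: w')); rewrite // -eqv word_val_nil.
- by case: (free (x :: w)); rewrite // eqv word_val_nil.
have [exy|nexy] := eqVneq x y.
  rewrite -exy in ovw' redw' eqv *.
  move/word_over_cons: ovw => [_ ovw]; move/word_over_cons: ovw' => [_ ovw'].
  move: eqv; rewrite !word_val_cons => /mulgI eqv; congr (_ :: _).
  by apply: IH => //; apply: (@reduced_catr _ [:: x]).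
case: (free (winv (x :: w) ++ y :: w')).
- by apply/word_over_cat; split=> //; apply: word_over_winv.
- rewrite winv_cons reduced_rcons_cat linvK eq_sym nexy redw' !andbT.
  by rewrite -winv_cons reduced_winv.
- by rewrite winv_cons; case: (winv w).
- by rewrite word_val_cat word_val_winv eqv mulVg.
Qed.

Lemma reduced_word_of B H g : free_basis B H -> H g ->
  exists w, [/\ word_over B w, reduced w & word_val w = g].
Proof.
case=> _ -> _ [w ov <-]; have [w' [red _ sub eqm]] := reduce_word w.
by exists w'; split=> // [l /sub/ov//|]; apply: (eqm _ id).
Qed.

(** A word of value 1 freely reduces to the empty word, so its image under
    [word_map f] is 1; the image of a word thus depends on its value only. *)
Lemma free_basis_lift K B H (f : G -> K) : free_basis B H ->
  exists F : G -> K, forall w, word_over B w -> F (word_val w) = word_map f w.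
Proof.
case=> _ _ free.
pose rep g : @word G := xget [::] [set w | word_over B w /\ word_val w = g].
exists (fun g => word_map f (rep g)) => w ov.
have [ovr eqr] : word_over B (rep (word_val w)) /\ word_val (rep (word_val w)) = word_val w.
  by apply: (xgetPex [::] (P := [set v | word_over B v /\ _ v = _])); exists w.
have [v [red _ sub eqm]] := reduce_word (rep (word_val w) ++ winv w).
have ovv : word_over B v.
  by move=> l /sub; move: l; apply/word_over_cat; split=> //; apply: word_over_winv.
have valv : word_val v = 1.
  by rewrite [LHS](eqm _ id) [LHS]word_val_cat word_val_winv eqr mulgV.
have v0 : v = [::] by apply: contrapT => /(free v ovv red).
move: (eqm K f); rewrite v0 word_map_cat word_map_winv /word_map big_nil.
by move/esym/divg1_eq.
Qed.

(** Replacing every letter [(b, e)] by [(b^-1, ~~ e)] changes neither the value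
    of a word nor whether it is reduced. *)
Lemma free_basis_inv B H : free_basis B H -> free_basis [set b^-1 | b in B] H.
Proof.
pose flip l : G * bool := (l.1^-1, ~~ l.2).
have flipK : involutive flip by case=> a e; rewrite /flip /= invgK negbK.
have val_flip w : word_val (map flip w) = word_val w.
  rewrite /word_val big_map; apply: eq_bigr => -[a []] _;
  by rewrite /letter_val //= invgK.
have over_flip C C' w : (forall c, C c -> C' c^-1) ->
    word_over C w -> word_over C' (map flip w).
  by move=> CC' ov _ /mapP[l /ov Cl ->]; apply: CC'.
have red_flip w : reduced (map flip w) = reduced w.
  rewrite !reducedE sorted_map; apply: eq_sorted => l l' /=.
  by rewrite -(inj_eq (inv_inj flipK) l').
have BV c : B c -> [set b^-1 | b in B] c^-1 by exists c.
have VB c : [set b^-1 | b in B] c -> B c^-1 by case=> b Bb <-; rewrite invgK.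
case=> sg HE free; split=> // [|w ov red w0].
  rewrite {1}HE; apply/seteqP; split=> _ [w ov <-];
  by exists (map flip w); rewrite ?val_flip //; apply: over_flip ov.
rewrite -val_flip; apply: free; first exact: over_flip ov.
  by rewrite red_flip.
by case: (w) w0.
Qed.

Lemma primitive_in_inv g H : primitive_in g H -> primitive_in g^-1 H.
Proof. by case=> B fB Bg; exists [set b^-1 | b in B]; [apply: free_basis_inv | exists g]. Qed.

End FreeBases.

(** * Minima and maxima of sets of natural numbers *)

Section Extrema.
Implicit Types (S : set nat) (k : nat).

Lemma min_natP S k : S k -> is_min S (min_nat S).
Proof.
move=> Sk; apply: (xgetPex 0%N (P := is_min S)).
have exS : exists j, `[< S j >] by exists k; apply/asboolP.
case: (ex_minnP exS) => m /asboolP Sm minm; exists m; split=> // j Sj.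
exact/minm/asboolP.
Qed.

Lemma max_nat_attained S : max_nat S = 0%N \/ S (max_nat S).
Proof. by rewrite /max_nat; case: xgetP => [_ -> []|]; [right|left]. Qed.

Lemma max_nat_ub S k : finite_set S -> S k -> (k <= max_nat S)%N.
Proof.
move=> /finite_seqP[s SE] Sk.
suff [] : is_max S (max_nat S) by move=> _; apply.
apply: (xgetPex 0%N (P := is_max S)).
have exS : exists j, `[< S j >] by exists k; apply/asboolP.
have ubS j : `[< S j >] -> (j <= \max_(i <- s) i)%N.
  by move=> /asboolP; rewrite SE => js; apply: leq_bigmax_seq.
case: (ex_maxnP exS ubS) => m /asboolP Sm maxm; exists m; split=> // j Sj.
exact/maxm/asboolP.
Qed.

End Extrema.

(** * Word length, powers and roots *)

Section Length.
Context {G : groupType}.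
Implicit Types (A B H : set G) (g h u : G) (l x y : G * bool).
Implicit Types (w s t r c : @word G).

Lemma word_length_le A w : word_over A w -> (word_length A (word_val w) <= size w)%N.
Proof.
move=> ov.
have Sw : [set size v |
    v in [set v | word_over A v /\ word_val v = word_val w]] (size w).
  by exists w.
by case: (min_natP Sw) => _; apply.
Qed.

Lemma word_length_reduced A H w : free_basis A H -> word_over A w -> reduced w ->
  word_length A (word_val w) = size w.
Proof.
move=> fA ov red; apply/eqP; rewrite eqn_leq word_length_le //=.
have Sw : [set size v | v in [set v | word_over A v /\ word_val v = word_val w]] (size w).
  by exists w.
case: (min_natP Sw) => -[v [ovv eqv] len] _.
have [v' [red' sz sub eqm]] := reduce_word v.
have v'E : v' = w.
  apply: (reduced_word_inj fA) => // [l /sub/ovv//|].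
  by rewrite [LHS](eqm _ id).
by move: sz; rewrite v'E len.
Qed.

Lemma finite_ball A n : finite_set A -> free_basis A [set: G] ->
  finite_set [set g | (word_length A g <= n)%N].
Proof.
move=> finA fA.
suff fin : finite_set [set word_val w | w in [set w | word_over A w /\ (size w <= n)%N]].
  apply: sub_finite_set fin => g /= len_g.
  have [w [ov red valw]] := reduced_word_of fA (I : [set: G] g).
  by exists w => //; split=> //; rewrite -(word_length_reduced fA) // valw.
elim: n => [|n IH].
  apply: (sub_finite_set _ (finite_set1 1)) => _ [[|l w] [_ //] _ <-].
  exact: word_val_nil.
have finL : finite_set [set letter_val l | l in [set l | A l.1]].
  have fin2 := finite_image2 (fun (a : G) e => letter_val (a, e)) finA
    (finite_finset (X := [set: bool])).
  by apply: sub_finite_set fin2 => _ [[a e] Aa <-]; exists a => //; exists e.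
have finM : finite_set _ := finite_image2 (fun a b : G => a * b) finL IH.
apply: (sub_finite_set _ (_ : finite_set (_ `|` _))); last first.
  by rewrite finite_setU; split; [exact: finite_set1 1 | exact: finM].
move=> _ [[|l w] [ov sz] <-]; first by left; rewrite word_val_nil.
move/word_over_cons: ov => [Al ov]; right.
by exists (letter_val l); [exists l | exists (word_val w); [exists w | rewrite word_val_cons]].
Qed.

(** Since [r] is nonempty, every junction of [s ++ r ++ t] already occurs in
    [s ++ r] or in [r ++ t]. *)
Lemma reduced_glue s r t : r <> [::] ->
  reduced (s ++ r) -> reduced (r ++ t) -> reduced (s ++ r ++ t).
Proof.
case/lastP: r => // r x _; case: t => [|y t]; first by rewrite cats0.
by rewrite -rcons_cat catA -rcons_cat !reduced_rcons_cat => -> /and3P[_ -> ->].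
Qed.

Lemma cyclic_reduction w : reduced w -> w <> [::] ->
  exists c r, [/\ w = c ++ r ++ winv c, r <> [::] & reduced (r ++ r)].
Proof.
have [n] := ubnP (size w); elim: n w => // n IH [//|x w].
case/lastP: w => [|m y] sz red _.
  exists [::], [:: x]; split=> //; rewrite [_ ++ _]/=.
  by rewrite reduced_cons2 eq_sym linv_neq.
have [ey|ney] := eqVneq y (linv x); last first.
  exists [::], (x :: rcons m y); split; rewrite ?cats0 // -rcons_cons.
  by rewrite reduced_rcons_cat rcons_cons red andbT /= eq_linv eq_sym.
have redm : reduced m.
  by move: red; rewrite -cats1 -cat1s => /reduced_catr/reduced_catl.
have m0 : m <> [::].
  by move=> m0; move: red; rewrite m0 reduced_cons2 ey eqxx.
have [|c [r [mE r0 red2]]] := IH m _ redm m0.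
  by move: sz; rewrite /= size_rcons ltnS => /ltnW.
exists (x :: c), r; split=> //.
by rewrite mE ey winv_cons -!cats1 /= -!catA.
Qed.

Lemma reduced_pow s r t k : r <> [::] -> reduced (r ++ r) ->
  reduced (s ++ r) -> reduced (r ++ t) ->
  reduced (s ++ flatten (nseq k.+1 r) ++ t).
Proof.
move=> r0 red2; elim: k s => [|k IH] s reds redt.
  by rewrite /= cats0; apply: reduced_glue.
by rewrite [flatten _]/= -catA; apply: reduced_glue => //; apply: IH.
Qed.

Lemma word_val_pow r k : word_val (flatten (nseq k r)) = word_val r ^+ k.
Proof.
elim: k => [|k IH]; first by rewrite word_val_nil.
by rewrite /= word_val_cat IH expgS.
Qed.

Lemma size_pow r k : size (flatten (nseq k r)) = (k * size r)%N.
Proof. by elim: k => // k IH; rewrite /= size_cat IH mulSn. Qed.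

Lemma word_over_pow A r k : word_over A r -> word_over A (flatten (nseq k r)).
Proof. by move=> ov; elim: k => // k IH; apply/word_over_cat. Qed.

(** If [c r c^-1] is the reduced word of [g] with [r] cyclically reduced, then
    [c r ... r c^-1] is the reduced word of [g ^+ k]. *)
Lemma word_length_expg A g k : free_basis A [set: G] -> g <> 1 -> (2 <= k)%N ->
  (word_length A g < word_length A (g ^+ k))%N.
Proof.
move=> fA g1 k2.
have [w [ov red valw]] := reduced_word_of fA (I : [set: G] g).
have w0 : w <> [::] by move=> w0; apply: g1; rewrite -valw w0 word_val_nil.
have [c [r [wE r0 red2]]] := cyclic_reduction red w0.
case: k k2 => // k k2; rewrite ltnS in k2.
have /word_over_cat[ovc /word_over_cat[ovr ovcV]] : word_over A (c ++ r ++ winv c).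
  by rewrite -wE.
have redk : reduced (c ++ flatten (nseq k.+1 r) ++ winv c).
  rewrite wE in red; apply: reduced_pow => //; last exact: reduced_catr red.
  by rewrite catA in red; exact: reduced_catl red.
have ovk : word_over A (c ++ flatten (nseq k.+1 r) ++ winv c).
  by apply/word_over_cat; split=> //; apply/word_over_cat; split=> //; apply: word_over_pow.
have valk : word_val (c ++ flatten (nseq k.+1 r) ++ winv c) = g ^+ k.+1.
  rewrite -valw wE !word_val_cat word_val_pow !word_val_winv.
  have := conjXg (word_val r) (word_val c)^-1 k.+1.
  by rewrite !conjgE invgK expgS.
rewrite -valk -{1}valw !(word_length_reduced fA) // wE !size_cat size_pow.
rewrite ltn_add2l ltn_add2r -[X in (X < _)%N]addn0 ltn_add2l muln_gt0 k2 /=.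
by case: (r) r0.
Qed.

(** A root of a proper power is strictly shorter, so taking roots terminates. *)
Lemma exists_root A g : free_basis A [set: G] -> g <> 1 ->
  exists u k, [/\ (0 < k)%N, u ^+ k = g, ~ proper_power u
                & (word_length A u <= word_length A g)%N].
Proof.
move=> fA; have [n] := ubnP (word_length A g); elim: n g => // n IH g len_g g1.
have [[h [j [j2 gE]]]|npp] := EM (proper_power g); last by exists g, 1%N.
have h1 : h <> 1 by move=> h1; apply: g1; rewrite gE h1 expg1n.
have hg : (word_length A h < word_length A g)%N by rewrite gE; apply: word_length_expg.
have [|u [k [k0 uk npp le]]] := IH h _ h1; first exact: leq_trans hg _.
exists u, (k * j)%N; split; rewrite ?muln_gt0 ?k0 ?(ltnW j2) //.
  by rewrite expgnA uk.
exact: leq_trans le (ltnW hg).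
Qed.

(** Let [x] and [y] be the first and last letters of the reduced word [w] of [g].
    If they involve the same generator, conjugate by another generator [z]: then
    [w z w z^-1] and [z w z^-1 w] are both reduced and start differently.
    Otherwise conjugate by [x]: then [w x w x^-1] is reduced, of length
    [2 |w| + 2], while in [x w x^-1 w] the letter [x^-1] cancels with the first
    letter of [w], leaving at most [2 |w|] letters. *)
Lemma noncommuting_conjugate A g : free_basis A [set: G] ->
  (forall a, exists2 b, A b & b <> a) -> g <> 1 ->
  exists2 z, A z.1 & ~ commute g (g ^ (letter_val z)^-1).
Proof.
move=> fA two g1.
have [w [ov red valw]] := reduced_word_of fA (I : [set: G] g).
have w0 : w <> [::] by move=> w0; apply: g1; rewrite -valw w0 word_val_nil.
have ovz z : A z.1 -> word_over A (w ++ z :: w ++ [:: linv z])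
                   /\ word_over A (z :: w ++ linv z :: w).
  by move=> Az; rewrite !(word_over_cons, word_over_cat, word_over1).
have valz z : word_val (w ++ z :: w ++ [:: linv z]) = g * g ^ (letter_val z)^-1
           /\ word_val (z :: w ++ linv z :: w) = g ^ (letter_val z)^-1 * g.
  rewrite !(word_val_cat, word_val_cons) word_val_nil letter_val_linv valw.
  by rewrite conjgE invgK !mulgA mulg1.
have redz z : reduced (w ++ [:: z]) -> reduced (z :: w) ->
    reduced (w ++ [:: linv z]) -> reduced (w ++ z :: w ++ [:: linv z]).
  move=> wz zw wz'; apply: (@reduced_glue w [:: z]) => //.
  exact: (@reduced_glue [:: z]).
case: w w0 => [//|x w1] _ in ov red valw ovz valz redz *.
have [w2 [y wE]] : exists w2 y, x :: w1 = rcons w2 y.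
  by exists (belast x w1), (last x w1); apply: lastI.
have Ax : A x.1 by move/word_over_cons: ov => [].
have red_r z : reduced ((x :: w1) ++ [:: z]) = (z != linv y).
  by rewrite wE reduced_rcons_cat -wE red /= andbT.
have red_l z : reduced (z :: x :: w1) = (x != linv z).
  by rewrite reduced_cons2 red andbT.
have neq_linv z z' : z.1 <> z'.1 -> z != linv z' by move=> ne; apply/eqP => zE; rewrite zE in ne.
have [exy|nexy] := EM (x.1 = y.1).
  have [b Ab bx] := two x.1; pose z := (b, false); exists z => // com.
  have [zx xz] : z.1 <> x.1 /\ x.1 <> z.1 by split=> // /esym.
  suff : (x :: w1) ++ z :: (x :: w1) ++ [:: linv z] = z :: (x :: w1) ++ linv z :: x :: w1.
    by case=> xzE; rewrite xzE in zx.
  have [ov1 ov2] := ovz z Ab; have [val1 val2] := valz z.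
  apply: (reduced_word_inj fA) => //; last by rewrite val1 val2.
  - by apply: redz; rewrite ?red_r ?red_l; apply: neq_linv; rewrite -?exy.
  - apply: (@reduced_glue [:: z]) => //; first by rewrite red_l; apply: neq_linv.
    apply: (@reduced_glue _ [:: linv z]) => //; rewrite ?red_r ?red_l;
    by apply: neq_linv; rewrite -?exy.
(* here [g] commutes with its conjugate by [x], so the shorter spelling of the
   product gives the contradiction on lengths *)
exists x => // com; have [ov1 ov2] := ovz x Ax; have [val1 val2] := valz x.
have ovs : word_over A (x :: (x :: w1) ++ w1).
  by move: ov; rewrite !(word_over_cons, word_over_cat); tauto.
have := word_length_le ovs.
have -> : word_val (x :: (x :: w1) ++ w1) = word_val ((x :: w1) ++ x :: (x :: w1) ++ [:: linv x]).
  rewrite val1 com -val2 !(word_val_cat, word_val_cons) letter_val_linv.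
  by rewrite mulKg.
rewrite (word_length_reduced fA) //.
  by rewrite /= !size_cat /= !size_cat /= addn1 !addnS !ltnS => /ltnW; rewrite ltnn.
apply: redz; rewrite ?red_r ?red_l; first exact: neq_linv.
  by rewrite eq_sym linv_neq.
by apply: neq_linv.
Qed.

End Length.

(** * M. Hall's theorem *)

(** The pairs in [s] are the graph of a partial injection.  A permutation [f]
    realising all pairs but [(a, b)] is corrected by exchanging [f a] and [b]; by
    injectivity neither is the prescribed image of another point. *)
Lemma perm_extending (T : finType) (s : seq (T * T)) :
  {in s &, forall p q, (p.1 == q.1) = (p.2 == q.2)} ->
  exists f : {perm T}, {in s, forall p, f p.1 = p.2}.
Proof.
elim: s => [|p s IH] inj_s; first by exists 1.
have [|f fs] := IH; first by move=> q q' qs q's; rewrite inj_s // inE ?qs ?q's orbT.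
exists (f * tperm (f p.1) p.2) => q; rewrite permM inE => /orP[/eqP->|qs].
  by rewrite tpermL.
have [pq|npq] := eqVneq p.1 q.1.
  by rewrite -pq tpermL; apply/eqP; rewrite -inj_s ?pq // inE ?eqxx ?qs ?orbT.
rewrite (fs q qs) tpermD //; first by rewrite -(fs q qs) (inj_eq perm_inj).
by rewrite -inj_s // inE ?eqxx ?qs ?orbT.
Qed.

Section Hall.
Context {G : groupType}.
Implicit Types (A B H : set G) (a g h u : G) (l x y : G * bool).
Implicit Types (w s t c : @word G).

(** The edge from [i] to [ordS i] of the cycle is labelled by the letter [i] of
    [r], inverse letters being read against the orientation of the edge.  Since
    [r] is cyclically reduced, the edges labelled by a given generator form a
    partial injection. *)
Lemma cyclic_graph_action (r : @word G) (x0 : G * bool) : reduced (r ++ r) ->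
  exists f : G -> {perm 'I_(size r)}, forall i : 'I_(size r), lift f (nth x0 r i) i = ordS i.
Proof.
move=> red2; have cyc (i : 'I_(size r)) : nth x0 r (ordS i) != linv (nth x0 r i).
  have lti : (i.+1 < size (r ++ r))%N.
    have := leq_add (ltn_ord i) (leq_ltn_trans (leq0n i) (ltn_ord i)).
    by rewrite addn1 size_cat.
  move: red2; rewrite reducedE => /(sortedP x0)/(_ i lti).
  rewrite !nth_cat ltn_ord /=; case: ltnP => [lt|ge]; first by rewrite modn_small.
  have -> : i.+1 = size r by apply/eqP; rewrite eqn_leq ge ltn_ord.
  by rewrite subnn modnn.
pose edge (i : 'I_(size r)) := if (nth x0 r i).2 then (ordS i, i) else (i, ordS i).
have /boolp.choice[f fP] : forall a, exists f : {perm 'I_(size r)}, forall i : 'I_(size r),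
    (nth x0 r i).1 = a -> f (edge i).1 = (edge i).2.
  move=> a; pose s := [seq edge i | i : 'I_(size r) <- enum 'I_(size r) & (nth x0 r i).1 == a].
  have [|f fs] := @perm_extending _ s; last first.
    exists f => i ia; apply: fs; apply/mapP; exists i => //.
    by rewrite mem_filter ia eqxx mem_enum.
  (* an edge labelled [a] and one labelled [a^-1] cannot be consecutive *)
  have ncons (i j : 'I_(size r)) : (nth x0 r i).1 = a -> (nth x0 r j).1 = a ->
      (nth x0 r i).2 != (nth x0 r j).2 -> (ordS i == j) = false.
    move=> ia ja sgn; apply/eqP => ij; have /eqP[] := cyc i; rewrite ij.
    by apply/eqP; rewrite /linv -pair_eqE /= ia ja eqxx /=; move: sgn; do 2 case: (_.2).
  move=> _ _ /mapP[i +->] /mapP[j + ->]; rewrite !mem_filter => /andP[/eqP ia _] /andP[/eqP ja _].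
  have := ncons i j ia ja; have := ncons j i ja ia; rewrite /edge.
  case: (_.2) (_.2) => [] [] /= ji ij; rewrite ?(inj_eq (@ordS_inj _)) //.
    by rewrite ij // [RHS]eq_sym ji.
  by rewrite ij // [LHS]eq_sym ji.
exists f => i; have := fP _ i erefl; rewrite /edge /lift.
by case: (_.2) => //= fi; apply: (canLR (permK _)).
Qed.

(** [act] is a right action of [G] on the vertices of the cycle: [perm] composes
    from left to right.  The vertex [ord0] is the base point, and the letter [m]
    of [r] labels the edge closing the cycle. *)

Section SchreierBasis.
Context (A : set G) (fA : free_basis A [set: G]).
Context (m : nat) (r : @word G) (x0 : G * bool).
Context (size_r : size r = m.+1) (ovr : word_over A r) (red2 : reduced (r ++ r)).
Context (act : G -> {perm 'I_m.+1}) (actM : {morph act : g h / g * h}).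
Context (act_r : forall i : 'I_m.+1, act (letter_val (nth x0 r i)) i = ordS i).
Implicit Types (i j : 'I_m.+1).

Definition stab : set G := [set g | act g ord0 = ord0].

(** The elements [trans i] are the prefixes of [r]; they lead from the base point
    to the vertex [i] along the spanning path. *)
Definition trans (n : nat) : G := word_val (take n r).

(** The directed edge labelled [l] starting at [n] belongs to the spanning path
    0, ..., m. *)
Definition tree (n : nat) l : bool :=
  (n < m)%N && (l == nth x0 r n) || (0 < n)%N && (l == linv (nth x0 r n.-1)).

Definition target i l : 'I_m.+1 := act (letter_val l) i.

Definition schreier i l : G := trans i * letter_val l * (trans (target i l))^-1.

Definition schreier_basis : set G :=
  [set schreier p.1 (p.2, false) |
    p in [set p : 'I_m.+1 * G | A p.2 /\ ~~ tree p.1 (p.2, false)]].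

Let act1 : act 1 = 1.
Proof. by apply: (mulgI (act 1)); rewrite -actM !mulg1. Qed.

Let actV g : act g^-1 = (act g)^-1.
Proof. by apply: (mulgI (act g)); rewrite -actM !mulgV act1. Qed.

Let red_r : reduced r. Proof. exact: reduced_catl red2. Qed.

Lemma trans0 : trans 0 = 1.
Proof. by rewrite /trans take0 word_val_nil. Qed.

Lemma transS (n : nat) : (n < m.+1)%N -> trans n.+1 = trans n * letter_val (nth x0 r n).
Proof. by move=> ltnm; rewrite /trans (take_nth x0) ?size_r // word_val_rcons. Qed.

Lemma act_trans i : act (trans i) ord0 = i.
Proof.
case: i => n; elim: n => [|n IH] ltnm; apply: val_inj => /=.
  by rewrite trans0 act1 perm1.
by rewrite transS ?(ltnW ltnm) // actM permM (IH (ltnW ltnm)) (act_r (Ordinal _)) /= modn_small.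
Qed.

Lemma target_linv i l : target (target i l) (linv l) = i.
Proof. by rewrite /target letter_val_linv actV permK. Qed.

Lemma tree_edge i l : tree i l ->
  tree (target i l) (linv l) /\ trans i * letter_val l = trans (target i l).
Proof.
rewrite {1}/tree => /orP[] /andP[lim /eqP lE].
  have -> : target i l = i.+1 :> nat by rewrite /target lE act_r /= modn_small.
  by rewrite transS // lE /tree /= eqxx orbT.
have [j jE] : exists j : 'I_m.+1, i = ordS j.
  by exists (ord_pred i); rewrite ord_predK.
have jm : (j < m)%N.
  rewrite ltn_neqAle -ltnS ltn_ord andbT; apply/eqP => jm.
  by move: lim; rewrite jE /= jm modnn.
have iE : i = j.+1 :> nat by rewrite jE /= modn_small.
rewrite iE /= in lE; have tgt : target i l = j.
  by rewrite /target lE letter_val_linv actV jE -act_r permK.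
rewrite tgt iE transS // lE letter_val_linv mulgK; split=> //.
by rewrite /tree jm linvK eqxx.
Qed.

Lemma tree_linv i l : tree (target i l) (linv l) = tree i l.
Proof.
by apply/idP/idP => /tree_edge[]; rewrite ?target_linv ?linvK.
Qed.

Lemma schreier_tree i l : tree i l -> schreier i l = 1.
Proof. by rewrite /schreier => /tree_edge[_ ->]; rewrite mulgV. Qed.

Lemma schreier_linv i l : schreier (target i l) (linv l) = (schreier i l)^-1.
Proof. by rewrite /schreier target_linv letter_val_linv !invgM invgK mulgA. Qed.

Lemma schreier_stab i l : stab (schreier i l).
Proof.
rewrite /stab /schreier /= !actM !actV !permM act_trans.
by apply: (canLR (permK _)); rewrite act_trans.
Qed.

Lemma is_subgroup_stab : is_subgroup stab.
Proof.
split=> [|g h]; first by rewrite !inE /stab /= act1 perm1.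
rewrite !inE /stab /= => g0 h0; rewrite actM permM g0 actV.
by apply: (canLR (permK _)).
Qed.

(** Reading a word from the base point, each letter [l] met at a vertex [i]
    contributes the Schreier generator of the edge [(i, l)], because
    [trans i * letter_val l = schreier i l * trans (target i l)]. *)
Lemma schreier_generation w : word_over A w ->
  exists v, word_over schreier_basis v /\
            word_val w = word_val v * trans (act (word_val w) ord0).
Proof.
elim/last_ind: w => [|w l IH] ov.
  by exists [::]; rewrite word_val_nil act1 perm1 trans0 mulg1.
have [ovw Al] := (word_over_rcons _ _ _).1 ov.
have [v [ovv wE]] := IH ovw; set i := act _ _ in wE.
suff [v' [ovv' v'E]] : exists v', word_over schreier_basis v' /\
    word_val v' = schreier i l.
  exists (v ++ v'); split; first exact/word_over_cat.
  rewrite word_val_rcons word_val_cat v'E actM permM -/i {1}wE.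
  by rewrite /schreier /target -!mulgA mulVg mulg1.
have [tr|ntr] := boolP (tree i l).
  by exists [::]; rewrite schreier_tree // word_val_nil.
case: l Al ntr {ov} => a [] /= Aa ntr.
  exists [:: (schreier (target i (a, true)) (a, false), true)].
  rewrite word_over1 word_val1 /letter_val /= (schreier_linv i (a, true)) invgK.
  split=> //; exists (target i (a, true), a) => //=.
    by split=> //; rewrite (tree_linv i (a, true)).
  by rewrite (schreier_linv i (a, true)).
exists [:: (schreier i (a, false), false)].
by rewrite word_over1 word_val1; split=> //; exists (i, a).
Qed.

(** The unique reduced path in the tree from [i] to [j], with the information on
    its first and last edges that controls cancellation at both ends. *)
Lemma tree_path i j : exists s, [/\ word_over A s, reduced s,
    word_val s = (trans i)^-1 * trans j
  & if i == j then s = [::] else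
    exists x y s1 s2, [/\ s = x :: s1, s = rcons s2 y, tree i x & tree j (linv y)]].
Proof.
wlog lij : i j / (i <= j)%N => [hw|].
  have [|lji] := leqP i j; first exact: hw.
  have [s [ovs reds vals]] := hw j i (ltnW lji).
  have nji : (j == i) = false by apply/eqP => ji; rewrite ji ltnn in lji.
  rewrite [i == j]eq_sym nji => -[x [y [s1 [s2 [sx sy tx ty]]]]].
  exists (winv s); rewrite reduced_winv word_val_winv vals invgM invgK.
  split=> //; first exact: word_over_winv.
  exists (linv y), (linv x), (winv s2), (winv s1).
  by rewrite {1}sy sx winv_rcons winv_cons linvK.
exists (drop i (take j r)).
have tk : take j r = take i r ++ drop i (take j r).
  by rewrite -{1}(cat_take_drop i (take j r)) take_takel.
have szj : size (take j r) = j by rewrite size_takel // size_r ltnW.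
have jpos : reduced (take j r) by apply: (@reduced_catl _ _ (drop j r)); rewrite cat_take_drop.
split.
- by move=> l /mem_drop/mem_take/ovr.
- by apply: (@reduced_catr _ (take i r)); rewrite -tk.
- by rewrite /trans [in RHS]tk word_val_cat mulKg.
have [->|nij] := eqVneq i j; first by rewrite drop_oversize // szj.
have ltij : (i < j)%N by rewrite ltn_neqAle lij nij.
have j0 : (0 < j)%N by apply: leq_trans ltij.
exists (nth x0 r i), (nth x0 r j.-1), (drop i.+1 (take j r)), (drop i (take j.-1 r)).
split.
- by rewrite (drop_nth x0) ?szj // nth_take.
- rewrite -{1}(prednK j0) (take_nth x0) ?size_r ?(leq_ltn_trans (leq_pred j)) //.
  rewrite drop_rcons // size_takel ?size_r ?(leq_trans (leq_pred j)) ?(ltnW (ltn_ord j)) //.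
  by rewrite -ltnS prednK.
- by rewrite /tree eqxx andbT (leq_trans ltij) // -ltnS.
- by rewrite /tree j0 eqxx orbT.
Qed.

(** A chosen edge giving the Schreier generator [g]; two edges might a priori
    give the same element of [G]. *)
Definition edge g : 'I_m.+1 * G :=
  xget (ord0, 1) [set p : 'I_m.+1 * G | [/\ A p.2, ~~ tree p.1 (p.2, false)
                            & schreier p.1 (p.2, false) = g]].

(** The letter [l] over the Schreier basis corresponds to the directed edge
    labelled [label l] that starts at [source l]: the edge chosen for [l.1],
    traversed backwards when [l] is an inverse letter. *)
Definition label l : G * bool := ((edge l.1).2, l.2).
Definition source l : 'I_m.+1 :=
  if l.2 then target (edge l.1).1 ((edge l.1).2, false) else (edge l.1).1.

Lemma edgeP l : schreier_basis l.1 ->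
  [/\ A (label l).1, ~~ tree (source l) (label l)
    & letter_val l = schreier (source l) (label l)].
Proof.
case: l => b e [p Ap pb].
have [Ae nte eb] : [/\ A (edge b).2, ~~ tree (edge b).1 ((edge b).2, false)
                            & schreier (edge b).1 ((edge b).2, false) = b].
  suff : exists q, [set q : 'I_m.+1 * G | [/\ A q.2, ~~ tree q.1 (q.2, false)
      & schreier q.1 (q.2, false) = b]] q by move/(xgetPex (ord0, 1)).
  by exists p; case: Ap.
rewrite /label /source /letter_val /=; case: e pb => /= _; split=> //.
  by rewrite (tree_linv _ (_, false)).
by rewrite (schreier_linv _ (_, false)) eb.
Qed.

Lemma edge_linv l :
  source (linv l) = target (source l) (label l) /\ label (linv l) = linv (label l).
Proof.
case: l => b [] //; split=> //.
by rewrite /source /label /= (target_linv _ (_, false)).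
Qed.

Lemma edge_inj l l' : schreier_basis l.1 -> schreier_basis l'.1 ->
  source l = source l' -> label l = label l' -> l = l'.
Proof.
move=> /edgeP[_ _ lE] /edgeP[_ _ l'E] eqs eql.
have : letter_val l = letter_val l' by rewrite lE l'E eqs eql.
have : l.2 = l'.2 by case: eql.
case: l l' {lE l'E eqs eql} => b e [b' e'] /= <-; rewrite /letter_val /=.
by case: e => [/invg_inj|] ->.
Qed.

(** A reduced word over the Schreier basis traces a path alternating between
    edges outside the tree and reduced paths inside the tree.  A tree edge and a
    non-tree edge leaving the same vertex have different labels, and consecutive
    non-tree edges are not inverse to each other because the given word is
    reduced; so the word over [A] read along the path is reduced and ends with
    the label of the last non-tree edge.  The invariant stops right after that
    edge, before the return to the base point, whence the factor [trans]. *)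
Lemma schreier_normal_form w l : word_over schreier_basis (rcons w l) ->
  reduced (rcons w l) ->
  exists s, [/\ word_over A (rcons s (label l)), reduced (rcons s (label l))
    & word_val (rcons w l) * trans (target (source l) (label l)) =
      word_val (rcons s (label l))].
Proof.
elim/last_ind: w l => [|w k IH] l ov red; have [ov' Bl] := (word_over_rcons _ _ _).1 ov;
  have [Al ntl lE] := edgeP Bl.
  have [s [ovs reds vals ends]] := tree_path ord0 (source l).
  exists s; split; first exact/word_over_rcons.
    case: eqP ends => [_ -> //|_ [x [y [_ [s2 [_ sE _ ty]]]]]].
    rewrite sE reduced_rcons2 -sE reds /=.
    by apply: contraNneq ntl => ->.
  rewrite !word_val_rcons word_val_nil mul1g lE vals trans0 invg1 mul1g.
  by rewrite /schreier mulgVK.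
have [redk nlk] : reduced (rcons w k) /\ l != linv k.
  by move: red; rewrite reduced_rcons2 => /andP[].
have Bk : schreier_basis k.1 by case/word_over_rcons: ov'.
have [s [ovs reds vals]] := IH k ov' redk.
have [_ ntk _] := edgeP Bk.
set i := target _ _ in vals.
have ntk' : ~~ tree i (linv (label k)) by rewrite tree_linv.
have [p [ovp redp valp ends]] := tree_path i (source l).
exists (rcons s (label k) ++ p); split.
- by apply/word_over_rcons; split=> //; apply/word_over_cat.
- case: eqP ends => [iE -> |_ [x [y [p1 [p2 [px py tx ty]]]]]].
    rewrite cats0 reduced_rcons2 reds /=; apply: contraNneq nlk => lk.
    have [srck labk] := edge_linv k.
    by apply/eqP/edge_inj; rewrite ?srck ?labk // -iE.
  rewrite -cats1 -catA; apply: reduced_glue; first by rewrite px.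
    rewrite px reduced_rcons_cat reds -px redp andbT /=.
    by apply: contraTneq tx => ->.
  rewrite cats1 py reduced_rcons2 -py redp /=.
  by apply: contraNneq ntl => ->.
- rewrite [LHS](_ : _ = word_val (rcons w k) * (letter_val l *
     trans (target (source l) (label l)))); last by rewrite word_val_rcons mulgA.
  rewrite lE /schreier mulgVK [RHS]word_val_rcons word_val_cat -vals valp.
  by rewrite !mulgA mulgK.
Qed.

(** If a nonempty reduced word had value 1, its normal form would be the prefix
    of [r] leading to the current vertex, whose last letter labels a tree edge. *)
Lemma schreier_basis_free : free_basis schreier_basis stab.
Proof.
split; first exact: is_subgroup_stab.
- apply/seteqP; split=> [g g0|_ [w ov <-]].
    have [w [ov _ wE]] := reduced_word_of fA (I : [set: G] g).
    have [v [ovv vE]] := schreier_generation ov.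
    by exists v => //; rewrite -wE vE wE g0 trans0 mulg1.
  have [st1 stD] := is_subgroup_stab; have stM := group_closedM is_subgroup_stab.
  have stV := group_closedV is_subgroup_stab.
  suff : word_val w \in stab by rewrite inE.
  elim: w ov => [|l w IH] ov; first by rewrite word_val_nil.
  have [Bl ovw] := (word_over_cons _ _ _).1 ov.
  rewrite word_val_cons; apply: stM; last exact: IH.
  by have [_ _ ->] := edgeP Bl; rewrite inE; apply: schreier_stab.
move=> w; case/lastP: w => // w l ov red _ w1.
have [s [ovs reds]] := schreier_normal_form ov red; rewrite w1 mul1g.
have [_ ntl _] := edgeP ((word_over_rcons _ _ _).1 ov).2.
set i := target _ _ => /esym sE.
have ti : rcons s (label l) = take i r.
  apply: (reduced_word_inj fA) => // [k /mem_take/ovr //|].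
  by apply: (@reduced_catl _ _ (drop i r)); rewrite cat_take_drop.
move: ntl; rewrite -tree_linv -/i /tree negb_or => /andP[_ /negP[]].
have szi : size (take i r) = i by rewrite size_takel // size_r ltnW.
have i0 : (0 < i)%N by rewrite -szi -ti size_rcons.
rewrite i0 /= -(nth_take x0 (n0 := i)) ?prednK // -ti.
by rewrite -szi -ti size_rcons nth_rcons ltnn eqxx.
Qed.

(** The closing edge of the cycle is outside the tree and its Schreier generator
    is [r].  The basis takes edges with positive labels only, so it contains the
    inverse of [r] when the last letter of [r] is an inverse letter. *)
Lemma primitive_in_stab : primitive_in (word_val r) stab.
Proof.
have rE : word_val r = trans m * letter_val (nth x0 r m).
  by rewrite -transS // /trans take_oversize // size_r.
pose i : 'I_m.+1 := ord_max.
have [l lE] : exists l, l = nth x0 r i by exists (nth x0 r i).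
have tgt : target i l = ord0.
  by rewrite /target lE act_r; apply: val_inj; rewrite /= modnn.
have Al : A l.1 by rewrite lE; apply/ovr/mem_nth; rewrite size_r.
have ntr : ~~ tree i l.
  rewrite /tree ltnn /= negb_and; case: (posnP m) => //= m0.
  move: red_r; rewrite reducedE => /(sortedP x0)/(_ m.-1).
  by rewrite prednK // size_r lE => /(_ (ltnSn _)).
have sE : schreier i l = word_val r by rewrite /schreier tgt trans0 divg1 rE lE.
suff [Bl|Bl] : schreier_basis (word_val r) \/ schreier_basis (word_val r)^-1.
- by exists schreier_basis => //; apply: schreier_basis_free.
- rewrite -[word_val r]invgK; apply: primitive_in_inv.
  by exists schreier_basis => //; apply: schreier_basis_free.
move: (i) (l) Al ntr sE => {tgt lE l i} j [a []] /= Aa ntr <-; last first.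
  by left; exists (j, a).
right; exists (target j (a, true), a); last by rewrite -schreier_linv.
by split=> //; rewrite (tree_linv j (a, true)).
Qed.

(** A left coset of [stab] consists of the elements that move one given vertex to
    the base point. *)
Lemma finite_index_stab : exists k, has_index stab k.
Proof.
suff [k cardk] : finite_set (left_cosets stab).
  by exists k; split=> //; apply: is_subgroup_stab.
pose coset i : set G := [set g | act g i = ord0].
have fin : finite_set [set coset i | i in [set: 'I_m.+1]].
  exact: finite_image (finite_finset).
apply: sub_finite_set fin => _ [g _ <-]; exists (act g^-1 ord0) => //.
apply/seteqP; split=> [h /= hE|_ [h h0 <-]]; last first.
  by rewrite /coset /= actM permM actV permKV.
by exists (g^-1 * h); rewrite ?mulVKg // /stab /= actM permM.
Qed.

End SchreierBasis.
End Hall.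

(** * Conjugate subgroups and homomorphisms to cyclic groups *)

Section FiniteIndex.
Context {G : groupType}.
Implicit Types (K : groupType) (A B H : set G) (a b g h u c : G) (w : @word G).

Lemma free_basis_hom K B H (f : G -> K) : free_basis B H ->
  exists F : G -> K, (forall g h, H g -> H h -> F (g * h) = F g * F h) /\
    forall l, B l.1 -> F (letter_val l) = lift f l.
Proof.
move=> fB; have [F FE] := free_basis_lift f fB; exists F; split=> [g h Hg Hh|l Bl].
  have [s [ovs _ <-]] := reduced_word_of fB Hg.
  have [t [ovt _ <-]] := reduced_word_of fB Hh.
  by rewrite -word_val_cat !FE ?word_map_cat //; apply/word_over_cat.
by rewrite -word_val1 FE ?word_map1 //; apply/word_over1.
Qed.

(** The conjugate of [H] by [c^-1], in the right-action convention
    [g ^ c = c^-1 * g * c]. *)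
Definition conj_set H c : set G := [set g | H (g ^ c)].

Lemma conj_setK H c : conj_set (conj_set H c) c^-1 = H.
Proof. by apply/seteqP; split=> g; rewrite /conj_set /= conjgKV. Qed.

Lemma is_subgroup_conj H c : is_subgroup H -> is_subgroup (conj_set H c).
Proof.
case=> H1 HF; split=> [|g h]; first by move: H1; rewrite !inE /conj_set /= conj1g.
rewrite !inE /conj_set /= => Hg Hh; rewrite conjMg conjVg.
by have := HF (g ^ c) (h ^ c); rewrite !inE; apply.
Qed.

(** Conjugation is an automorphism of [G], so it induces a bijection between the
    left cosets of [H] and those of its conjugate. *)
Lemma has_index_conj H c k : has_index H k -> has_index (conj_set H c) k.
Proof.
case=> sgH cardH; split; first exact: is_subgroup_conj.
apply: card_eq_trans cardH.
have -> : left_cosets (conj_set H c) = (fun S => conj_set S c) @` left_cosets H.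
  apply/seteqP; split=> [_ [g _ <-]|_ [_ [g _ <-] <-]].
    exists [set g ^ c * h | h in H]; first by exists (g ^ c).
    apply/seteqP; split=> [h [h' Hh' /(congr1 (fun z => z ^ c^-1))]|_ [h Hh <-]].
      rewrite conjMg !conjgK => <-; exists (h' ^ c^-1) => //.
      by rewrite /conj_set /= conjgKV.
    by exists (h ^ c); rewrite // conjMg.
  exists (g ^ c^-1) => //; apply/seteqP; split=> [_ [h Hh <-]|h [h' Hh' h'E]].
    by exists (h ^ c); rewrite // conjMg conjgKV.
  exists (h' ^ c^-1); first by rewrite /conj_set /= conjgKV.
  by rewrite -conjMg h'E conjgK.
apply: inj_card_eq => S S' _ _ /(congr1 (fun T => conj_set T c^-1)).
by rewrite !conj_setK.
Qed.

Lemma free_basis_conj B H c : free_basis B H -> free_basis (conj_set B c) (conj_set H c).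
Proof.
pose cj d (l : G * bool) := (l.1 ^ d, l.2).
have cjK d : cancel (cj d) (cj d^-1) by case=> a e; rewrite /cj /= conjgK.
have val_cj d w : word_val (map (cj d) w) = word_val w ^ d.
  rewrite /word_val conjg_prod big_map; apply: eq_bigr => -[a e] _.
  by rewrite /letter_val /=; case: e; rewrite ?conjVg.
have red_cj d w : reduced (map (cj d) w) = reduced w.
  rewrite !reducedE sorted_map; apply: eq_sorted => l l' /=.
  by rewrite -(inj_eq (can_inj (cjK d)) l').
have over_cj w : word_over B w -> word_over (conj_set B c) (map (cj c^-1) w).
  by move=> ov _ /mapP[l /ov Bl ->]; rewrite /conj_set /= conjgKV.
have over_cjV w : word_over (conj_set B c) w -> word_over B (map (cj c) w).
  by move=> ov _ /mapP[l /ov Bl ->].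
case=> sgH HE free; split=> [||w ov red w0]; first exact: is_subgroup_conj.
- rewrite {1}HE; apply/seteqP; split=> [g [w ov wg]|_ [w ov <-]].
    by exists (map (cj c^-1) w); [exact: over_cj | rewrite val_cj wg conjgK].
  by exists (map (cj c) w); [exact: over_cjV | rewrite val_cj].
move=> w1; apply: (free (map (cj c) w)); rewrite ?red_cj ?val_cj ?w1 ?conj1g //.
  exact: over_cjV.
by case: (w) w0.
Qed.

(** M. Hall's theorem for cyclic subgroups: [u = c r c^-1] with [r] cyclically
    reduced, and [r] is primitive in the stabiliser of a vertex of its cycle. *)
Theorem primitive_in_finite_index A u : free_basis A [set: G] -> u <> 1 ->
  exists k H, has_index H k /\ primitive_in u H.
Proof.
move=> fA u1; have [w [ov red valw]] := reduced_word_of fA (I : [set: G] u).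
have w0 : w <> [::] by move=> w0; apply: u1; rewrite -valw w0 word_val_nil.
have [c [r [wE r0 red2]]] := cyclic_reduction red w0.
have /word_over_cat[_ /word_over_cat[ovr _]] : word_over A (c ++ r ++ winv c).
  by rewrite -wE.
have [m size_r] : exists m, size r = m.+1 by case: (r) r0 => // x s _; exists (size s).
pose x0 : G * bool := (1, false).
have [f fr] := cyclic_graph_action x0 red2; rewrite size_r in f fr.
have [act [actM actl]] := free_basis_hom f fA.
have actr (i : 'I_m.+1) : act (letter_val (nth x0 r i)) i = ordS i.
  by rewrite actl //; apply/ovr/mem_nth; rewrite size_r.
have actM' : {morph act : g h / g * h} by move=> g h; apply: actM.
have [k idx] := finite_index_stab actM'.
have [B fB Br] := primitive_in_stab fA size_r ovr red2 actM' actr.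
exists k, (conj_set (stab act) (word_val c)); split; first exact: has_index_conj.
exists (conj_set B (word_val c)); first exact: free_basis_conj.
rewrite /conj_set /= -valw wE !word_val_cat word_val_winv conjgE.
by rewrite !mulgA mulVg mul1g mulgVK.
Qed.

(** The homomorphism from [H] to the integers modulo [k + 2] that sends [u] to 1
    and the rest of the basis to 0 kills commutators and sends [u ^+ k] to [k]. *)
Lemma primitive_power_ncommg H u g h k : primitive_in u H -> H g -> H h ->
  u ^+ k = [~ g, h] -> k = 0%N.
Proof.
case=> B fB Bu Hg Hh uk.
have sgH : is_subgroup H by case: fB.
pose f b : 'I_k.+2 := if b == u then inZp 1 else 1.
have [F [FM Fl]] := free_basis_hom f fB.
have H1 : H 1 by case: sgH; rewrite inE.
have HM a b : H a -> H b -> H (a * b).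
  by move=> Ha Hb; have := group_closedM sgH (x := a) (y := b); rewrite !inE; apply.
have HV a : H a -> H a^-1.
  by move=> Ha; have := group_closedV sgH (x := a); rewrite !inE; apply.
have F1 : F 1 = 1 by apply: (mulgI (F 1)); rewrite -FM // !mulg1.
have FV a : H a -> F a^-1 = (F a)^-1.
  by move=> Ha; apply: (mulgI (F a)); rewrite -FM ?mulgV ?F1 //; apply: HV.
have Hu : H u.
  case: fB => _ -> _; exists [:: (u, false)]; last by rewrite word_val1.
  exact/word_over1.
have Fu : F u = inZp 1 by have := Fl (u, false) Bu; rewrite /lift /letter_val /= /f eqxx.
have Fuk j : F (u ^+ j) = F u ^+ j /\ H (u ^+ j).
  elim: j => [|j [IH Hj]]; first by rewrite expg0 F1.
  by rewrite !expgS FM // IH; split=> //; apply: HM.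
have : F (u ^+ k) = 1.
  have [HgV HhV Hgh] := And3 (HV g Hg) (HV h Hh) (HM g h Hg Hh).
  rewrite uk commgEl conjgE (FM _ _ HgV) ?(FM _ _ HhV) ?(FM g h) ?FV //; try by apply: HM.
  by rewrite [F g * F h]Zp_mulgC mulKg mulVg.
rewrite (Fuk k).1 Fu Zp_expg => /(congr1 val) /=.
by rewrite !modnMml mul1n modn_small.
Qed.

End FiniteIndex.

(** * The primitivity index and the residual finiteness growth *)

Section Indices.
Context {G : groupType}.
Implicit Types (A B H : set G) (g h u c : G).

Lemma two_generators A N : (2 <= N)%N -> (A #= `I_N)%card ->
  forall a, exists2 b, A b & b <> a.
Proof.
move=> N2 cardA a; apply: contrapT => nob.
have sub : A `<=` [set a] by move=> b Ab; apply: contrapT => ba; apply: nob; exists b.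
have := subset_card_le sub.
by rewrite (card_le_eql cardA) (card_le_eqr card_set1) card_le_II leqNgt N2.
Qed.

Lemma Dindex_le H g c k : has_index H k -> ~ H (g ^ c) -> (Dindex g <= k)%N.
Proof.
move=> idx nH; have Sk : [set k | exists2 H : set G, has_index H k & ~ H g] k.
  by exists (conj_set H c) => //; apply: has_index_conj.
by case: (min_natP Sk) => _; apply.
Qed.

Lemma dprim_attained A u : free_basis A [set: G] -> u <> 1 ->
  exists2 H, has_index H (dprim u) & primitive_in u H.
Proof.
move=> fA u1; have [k [H [idx prim]]] := primitive_in_finite_index fA u1.
have Hu : H u.
  by case: prim => B [_ -> _] Bu; exists [:: (u, false)]; [exact/word_over1 | rewrite word_val1].
have Sk : [set k | exists2 H : set G, has_index H k & H u /\ primitive_in u H] k by exists H.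
by case: (min_natP Sk) => -[H' idx' [_ prim'] _]; exists H'.
Qed.

Lemma Dindex_le_dprim A g c u k : free_basis A [set: G] -> (0 < k)%N ->
  u <> 1 -> u ^+ k = [~ g, g ^ c] -> (Dindex g <= dprim u)%N.
Proof.
move=> fA k0 u1 uk; have [H idx prim] := dprim_attained fA u1.
have [Hg|] := EM (H g); last by rewrite -{1}(conjg1 g); apply: Dindex_le.
have [Hgc|] := EM (H (g ^ c)); last exact: Dindex_le.
by move: k0; rewrite (primitive_power_ncommg prim Hg Hgc uk).
Qed.

(** A conjugate by a letter costs two letters, and [g] and its conjugate each
    occur twice in the commutator. *)
Lemma word_length_commg_conj A g l : free_basis A [set: G] -> A l.1 ->
  (word_length A [~ g, g ^ (letter_val l)^-1] <= 4 * word_length A g + 4)%N.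
Proof.
move=> fA Al; have [w [ov red <-]] := reduced_word_of fA (I : [set: G] g).
pose cw v := l :: v ++ [:: linv l].
have cwE v : word_val (cw v) = word_val v ^ (letter_val l)^-1.
  by rewrite word_val_cons word_val_cat word_val1 letter_val_linv conjgE invgK.
have ovw' := word_over_winv ov.
have ovc : word_over A (winv w ++ cw (winv w) ++ w ++ cw w).
  by rewrite !(word_over_cat, word_over_cons, word_over1).
have -> : [~ word_val w, word_val w ^ (letter_val l)^-1] =
    word_val (winv w ++ cw (winv w) ++ w ++ cw w).
  by rewrite !word_val_cat !cwE word_val_winv conjVg.
rewrite (word_length_reduced fA ov red); apply: leq_trans (word_length_le ovc) _.
rewrite !size_cat /= !size_cat /= size_winv; apply: eq_leq.
by rewrite !mulSn !mul0n; rewrite !(addn1, addnS, addSn, addn0) !addnA.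
Qed.

Lemma dprim_le_fprim A u n : finite_set A -> free_basis A [set: G] ->
  (word_length A u <= n)%N -> u <> 1 -> ~ proper_power u -> (dprim u <= fprim A n)%N.
Proof.
move=> finA fA len u1 npp; apply: max_nat_ub; last by exists u.
apply: finite_image; apply: sub_finite_set (finite_ball n finA fA) => g.
by case.
Qed.

End Indices.

Theorem theoremA1 (G : groupType) (N : nat) (A : set G)
    (hN : (2 <= N)%N) (hA : free_basis A [set: G]) (hAN : (A #= `I_N)%card)
    (n : nat) (hn : (1 <= n)%N) :
  (RF A n <= fprim A (4 * n + 4))%N.
Proof.
(* when no element attains the maximum, [RF A n] is 0 *)
have [rf0|] := max_nat_attained [set Dindex g | g in
    [set g | (word_length A g <= n)%N /\ g <> 1%g]].
  by rewrite /RF rf0.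
rewrite -/(RF A n) => -[g [len_g g1] <-].
have [l Al ncom] := noncommuting_conjugate hA (two_generators hN hAN) g1.
set c := ((letter_val l)^-1)%g in ncom.
have w1 : [~ g, g ^ c]%g <> 1%g by move/eqP/commgP.
have [u [k [k0 uk npp len_u]]] := exists_root hA w1.
have u1 : u <> 1%g by move=> u1; apply: w1; rewrite -uk u1 expg1n.
apply: leq_trans (Dindex_le_dprim hA k0 u1 uk) _.
apply: dprim_le_fprim => //; first by exists N.
apply: leq_trans len_u (leq_trans (word_length_commg_conj g hA Al) _).
by rewrite leq_add2r leq_mul2l.
Qed.
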